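(* Let $\mathscr H$ be a complex Hilbert space of dimension $4$ and let $\mathcal S=(\gamma_1,\gamma_2)$ be a pair of weighted density operators on $\mathscr H$ with $\operatorname{supp}\gamma_1\cap\operatorname{supp}\gamma_2=\{0\}$, $\ker\gamma_1\cap\ker\gamma_2=\{0\}$, $\operatorname{supp}\gamma_1\cap\ker\gamma_2=\{0\}$ and $\ker\gamma_1\cap\operatorname{supp}\gamma_2=\{0\}$. Let the vectors $|k_{\mu i}\rangle$ and the numbers $c,\varphi,g_{\mu i},g_{\mu3},g_\mu$ be as described in the context, and for real $x$ let $A_1,A_2,B_1,B_2,B_3$ be the functions of $x$ defined in the context. Collect candidates for the orthonormal bases $(|\psi_1\rangle,|\psi_1^\perp\rangle)$ of $\ker\gamma_2$ and $(|\psi_2\rangle,|\psi_2^\perp\rangle)$ of $\ker\gamma_1$ as follows. (i) If $\sin\varphi=0$ and $cg_{23}=g_{13}$, then $(|\psi_1\rangle=|k_{21}\rangle,\ |\psi_1^\perp\rangle=|k_{22}\rangle)$ and $(|\psi_2\rangle=|k_{12}\rangle,\ |\psi_2^\perp\rangle=|k_{11}\rangle)$ is a candidate. (ii) If $\sin\varphi=0$ and $cg_{13}=g_{23}$, then $(|\psi_1\rangle=|k_{22}\rangle,\ |\psi_1^\perp\rangle=|k_{21}\rangle)$ and $(|\psi_2\rangle=|k_{11}\rangle,\ |\psi_2^\perp\rangle=|k_{12}\rangle)$ is a candidate. (iii) For any real root $x\ne0$ of $$B_1^2(A_1^2+A_2^2)-(A_1B_2-A_2B_3)^2=0$$ one gets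 a unique value for $\vartheta$, $-\pi/2\le\vartheta<\pi/2$, from $$A_1\sin\vartheta=A_2\cos\vartheta\qquad(\text{if }A_1\ne0\text{ or }A_2\neq0)$$ or from $$2\cos\vartheta\,g_{13}g_{23}(cg_{23}-g_{13})=xc\,(g_{23}^2g_1-g_{13}^2g_2)\qquad(\text{if }A_1=0\text{ and }A_2=0).$$ If $A_1\neq0$ or $A_2\ne0$, then in addition $B_1=B_3\sin\vartheta-B_2\cos\vartheta$ has to hold. For each such $(x,\vartheta)$ a candidate is given by $$|\psi_1\rangle=(1+x^2)^{-1/2}(|k_{21}\rangle+xe^{i\vartheta}|k_{22}\rangle),\quad |\psi_1^\perp\rangle=(1+x^2)^{-1/2}(xe^{-i\vartheta}|k_{21}\rangle-|k_{22}\rangle),$$ $$|\psi_2\rangle=(1+c^2x^2)^{-1/2}(-xe^{-i\vartheta}c|k_{11}\rangle+|k_{12}\rangle),\quad |\psi_2^\perp\rangle=(1+c^2x^2)^{-1/2}(-|k_{11}\rangle-xe^{i\vartheta}c|k_{12}\rangle).$$ At most one of the candidates satisfies both $$|\langle\psi_1^\perp|\psi_2\rangle|^2\langle\psi_2|\gamma_2|\psi_2\rangle\ge\langle\psi_1^\perp|\gamma_1|\psi_1^\perp\rangle\quad\text{and}\quad |\langle\psi_2^\perp|\psi_1\rangle|^2\langle\psi_1|\gamma_1|\psi_1\rangle\ge\langle\psi_2^\perp|\gamma_2|\psi_2^\perp\rangle .$$ If such a candidate exists, the optimal USD measurement $(E_1,E_2,E_?)$ of $\mathcal S$ is given by $E_1=|\psi_1\rangle\langle\psi_1|$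 and $E_2=|\psi_2\rangle\langle\psi_2|$ (and $E_?=1-E_1-E_2$).
   Context: A weighted density operator is a positive semi-definite operator on $\mathscr H$ (no normalization of the trace is required). For a positive semi-definite operator $\rho$, $\operatorname{supp}\rho=(\ker\rho)^\perp$. A USD (unambiguous state discrimination) measurement of $\mathcal S$ is a triple $(E_1,E_2,E_?)$ of positive semi-definite operators on $\mathscr H$ with $E_1+E_2+E_?=1$ (identity), $\operatorname{tr}(E_2\gamma_1)=0$ and $\operatorname{tr}(E_1\gamma_2)=0$. Its success probability is $\operatorname{tr}(E_1\gamma_1)+\operatorname{tr}(E_2\gamma_2)$; it is optimal if its success probability is maximal among all USD measurements of $\mathcal S$. For pairs with $\ker\gamma_1\cap\ker\gamma_2=\{0\}$ the optimal USD measurement is unique. The procedure in the claim concerns the measurement class $[1,1]$, i.e. optimal measurements with $\operatorname{rank}E_1=1=\operatorname{rank}E_2$. Choice of bases. Under the stated hypotheses $\ker\gamma_1$ and $\ker\gamma_2$ are two-dimensional. Let $(|k_{11}\rangle,|k_{12}\rangle)$ and $(|k_{21}\rangle,|k_{22}\rangle)$ be Jordan bases of $\ker\gamma_1$ and $\ker\gamma_2$, i.e. orthonormal bases of $\ker\gamma_1$ and $\ker\gamma_2$, respectively, with $\langle k_{1i}|k_{2j}\rangle=0$ for $i\neq j$ and $\langle k_{1l}|k_{2l}\rangle\ge0$; the hypotheses imply $0<\langle k_{1l}|k_{2l}\rangle<1$. They are ordered so that $\langle k_{11}|k_{21}\rangle\ge\langle k_{12}|k_{22}\rangle$; if $\langle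 k_{11}|k_{21}\rangle=\langle k_{12}|k_{22}\rangle$ they are chosen such that $\langle k_{21}|\gamma_1|k_{22}\rangle=0$. Put $g_{1i}=\langle k_{2i}|\gamma_1|k_{2i}\rangle$, $g_{2i}=\langle k_{1i}|\gamma_2|k_{1i}\rangle$ ($i=1,2$), $g_{13}=|\langle k_{21}|\gamma_1|k_{22}\rangle|$, $g_{23}=|\langle k_{11}|\gamma_2|k_{12}\rangle|$, $g_\mu=g_{\mu1}-g_{\mu2}$, and $c=\langle k_{12}|k_{22}\rangle/\langle k_{11}|k_{21}\rangle$. The phases of $|k_{12}\rangle$ and $|k_{22}\rangle$ are chosen (keeping $\langle k_{12}|k_{22}\rangle>0$) such that $\langle k_{21}|\gamma_1|k_{22}\rangle=g_{13}e^{i\varphi}$ and $\langle k_{11}|\gamma_2|k_{12}\rangle=g_{23}e^{-i\varphi}$ with $0\le\varphi<\pi$, and with $\varphi=0$ if $g_{13}=0$ or $g_{23}=0$. Functions of $x$: $$A_1=\bigl(c(x^2+1)g_{23}-(x^2c^2+1)g_{13}\bigr)\cos\varphi,\quad A_2=\bigl(c(x^2+1)g_{23}+(x^2c^2+1)g_{13}\bigr)\sin\varphi,$$ $$B_1=(x^2c^2+1)^2xg_1-c(x^2+1)^2xcg_2,$$ $$B_2=\bigl[(x^2c^2+1)^2g_{13}(x^2-1)-c(x^2+1)^2g_{23}(x^2c^2-1)\bigr]\cos\varphi,$$ $$B_3=\bigl[(x^2c^2+1)^2g_{13}(x^2-1)+c(x^2+1)^2g_{23}(x^2c^2-1)\bigr]\sin\varphi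 .$$ The polynomial in (iii) is trivial if and only if $g_{13}=g_{23}=0$, and in that case no choice with $x\ne0$ yields an optimal measurement; in any other situation it has finitely many real roots $x\neq0$.
   Formalization: If A1=A2=0, the equation fixes only cos ϑ, so ϑ need not be unique or exist; the formal claim is that cos ϑ is unique, and every solution ϑ in range counts as a candidate. Case (iii) is not applied when g13=g23=0, where the polynomial is trivial. *)

(* Defs.v *)
From HB Require Import structures.
From mathcomp Require Import all_boot all_order all_algebra.
From mathcomp Require Import sesquilinear complex.
From mathcomp Require Import reals trigo.

Set Implicit Arguments.
Unset Strict Implicit.
Unset Printing Implicit Defensive.

Import Order.TTheory GRing.Theory Num.Theory.
Local Open Scope ring_scope.
Local Open Scope complex_scope.

(* A finite-dimensional complex Hilbert space is a vector type [H] over [R[i]]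
   with a form [ip : {dot H for Num.conj}]. The form [ip] is linear in its
   first argument; [braket] is the physicists' bracket <u|v>, linear in [v]. *)
Definition braket (R : realType) (H : vectType R[i])
  (ip : {dot H for Num.conj}) (u v : H) : R[i] := ip v u.

Definition ketbra_fun (R : realType) (H : vectType R[i])
  (ip : {dot H for Num.conj}) (u v w : H) : H := braket ip v w *: u.

Fact ketbra_fun_is_linear (R : realType) (H : vectType R[i])
  (ip : {dot H for Num.conj}) (u v : H) : linear (ketbra_fun ip u v).
Proof. by move=> a x y; rewrite /ketbra_fun /braket linearPl scalerDl scalerA. Qed.

HB.instance Definition _ (R : realType) (H : vectType R[i])
  (ip : {dot H for Num.conj}) (u v : H) :=
  GRing.isLinear.Build R[i] H H *:%R (ketbra_fun ip u v)
    (ketbra_fun_is_linear ip u v).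

(* |u><v| *)
Definition ketbra (R : realType) (H : vectType R[i])
  (ip : {dot H for Num.conj}) (u v : H) : 'End(H) :=
  linfun (ketbra_fun ip u v).

Definition trlf (R : realType) (H : vectType R[i]) (A : 'End(H)) : R[i] :=
  \tr (passmx.mxof (vbasis {:H}) (vbasis {:H}) A).

(* [0 <= z] in [R[i]] says that [z] is real and nonnegative, so that a positive
   semi-definite operator is automatically self-adjoint. *)
Definition psd (R : realType) (H : vectType R[i])
  (ip : {dot H for Num.conj}) (A : 'End(H)) : Prop :=
  forall v : H, 0 <= braket ip v (A v).

Definition supp (R : realType) (H : vectType R[i])
  (ip : {dot H for Num.conj}) (A : 'End(H)) : {vspace H} :=
  orthov ip (lker A).

Definition is_usd (R : realType) (H : vectType R[i])
  (ip : {dot H for Num.conj}) (gamma1 gamma2 E1 E2 Eq : 'End(H)) : Prop :=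
  [/\ psd ip E1, psd ip E2 & psd ip Eq] /\
  [/\ E1 + E2 + Eq = \1%VF,
      trlf (E2 \o gamma1)%VF = 0 & trlf (E1 \o gamma2)%VF = 0].

Definition success (R : realType) (H : vectType R[i])
  (gamma1 gamma2 E1 E2 : 'End(H)) : R[i] :=
  trlf (E1 \o gamma1)%VF + trlf (E2 \o gamma2)%VF.

(* Success probabilities of USD measurements are real; the order of [R[i]]
   compares them as such. *)
Definition is_optimal_usd (R : realType) (H : vectType R[i])
  (ip : {dot H for Num.conj}) (gamma1 gamma2 E1 E2 Eq : 'End(H)) : Prop :=
  is_usd ip gamma1 gamma2 E1 E2 Eq /\
  forall F1 F2 Fq : 'End(H), is_usd ip gamma1 gamma2 F1 F2 Fq ->
    success gamma1 gamma2 F1 F2 <= success gamma1 gamma2 E1 E2.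

(* Ordered Jordan bases [(k11, k12)] of [ker gamma1] and [(k21, k22)] of
   [ker gamma2]; the last clause fixes the freedom left when the two overlaps
   coincide. *)
Definition jordan_bases (R : realType) (H : vectType R[i])
  (ip : {dot H for Num.conj}) (gamma1 gamma2 : 'End(H))
  (k11 k12 k21 k22 : H) : Prop :=
  [/\ basis_of (lker gamma1) [:: k11; k12] /\ orthonormal ip [:: k11; k12],
      basis_of (lker gamma2) [:: k21; k22] /\ orthonormal ip [:: k21; k22],
      braket ip k11 k22 = 0 /\ braket ip k12 k21 = 0,
      0 <= braket ip k11 k21 /\ 0 <= braket ip k12 k22 &
      braket ip k12 k22 <= braket ip k11 k21 /\
      (braket ip k11 k21 = braket ip k12 k22 ->
       braket ip k21 (gamma1 k22) = 0)].

Record coeffs (R : realType) := Coeffs {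
  cc : R; phi : R;
  g11 : R; g12 : R; g13 : R;
  g21 : R; g22 : R; g23 : R }.

Definition expi (R : realType) (t : R) : R[i] := cos t +i* sin t.

(* The clauses on [phi] express the choice of the phases of [k12] and [k22]. *)
Definition coeffs_of (R : realType) (H : vectType R[i])
  (ip : {dot H for Num.conj}) (gamma1 gamma2 : 'End(H))
  (k11 k12 k21 k22 : H) (p : coeffs R) : Prop :=
  [/\ (cc p)%:C = braket ip k12 k22 / braket ip k11 k21,
      [/\ (g11 p)%:C = braket ip k21 (gamma1 k21),
          (g12 p)%:C = braket ip k22 (gamma1 k22),
          (g21 p)%:C = braket ip k11 (gamma2 k11) &
          (g22 p)%:C = braket ip k12 (gamma2 k12)],
      (g13 p)%:C = `|braket ip k21 (gamma1 k22)| /\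
      (g23 p)%:C = `|braket ip k11 (gamma2 k12)|,
      braket ip k21 (gamma1 k22) = (g13 p)%:C * expi (phi p) /\
      braket ip k11 (gamma2 k12) = (g23 p)%:C * expi (- phi p) &
      0 <= phi p < pi /\ (g13 p = 0 \/ g23 p = 0 -> phi p = 0)].

Definition g1 (R : realType) (p : coeffs R) : R := g11 p - g12 p.
Definition g2 (R : realType) (p : coeffs R) : R := g21 p - g22 p.

Definition A1 (R : realType) (p : coeffs R) (x : R) : R :=
  let c := cc p in
  (c * (x ^+ 2 + 1) * g23 p - (x ^+ 2 * c ^+ 2 + 1) * g13 p) * cos (phi p).

Definition A2 (R : realType) (p : coeffs R) (x : R) : R :=
  let c := cc p in
  (c * (x ^+ 2 + 1) * g23 p + (x ^+ 2 * c ^+ 2 + 1) * g13 p) * sin (phi p).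

Definition B1 (R : realType) (p : coeffs R) (x : R) : R :=
  let c := cc p in
  (x ^+ 2 * c ^+ 2 + 1) ^+ 2 * x * g1 p
  - c * (x ^+ 2 + 1) ^+ 2 * x * c * g2 p.

Definition B2 (R : realType) (p : coeffs R) (x : R) : R :=
  let c := cc p in
  ((x ^+ 2 * c ^+ 2 + 1) ^+ 2 * g13 p * (x ^+ 2 - 1)
   - c * (x ^+ 2 + 1) ^+ 2 * g23 p * (x ^+ 2 * c ^+ 2 - 1)) * cos (phi p).

Definition B3 (R : realType) (p : coeffs R) (x : R) : R :=
  let c := cc p in
  ((x ^+ 2 * c ^+ 2 + 1) ^+ 2 * g13 p * (x ^+ 2 - 1)
   + c * (x ^+ 2 + 1) ^+ 2 * g23 p * (x ^+ 2 * c ^+ 2 - 1)) * sin (phi p).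

(* The first clause excludes the case in which the polynomial vanishes
   identically. Then every [x] would be a root and the equation for the angle
   would read 0 = 0, so that no [x] is to be used. *)
Definition nonzero_root (R : realType) (p : coeffs R) (x : R) : Prop :=
  [/\ g13 p != 0 \/ g23 p != 0, x != 0 &
      B1 p x ^+ 2 * (A1 p x ^+ 2 + A2 p x ^+ 2)
      - (A1 p x * B2 p x - A2 p x * B3 p x) ^+ 2 = 0].

Definition angle_range (R : realType) (t : R) : Prop := - (pi / 2) <= t < pi / 2.

Definition angle_eq (R : realType) (p : coeffs R) (x t : R) : Prop :=
  A1 p x * sin t = A2 p x * cos t.

Definition angle_eq_degenerate (R : realType) (p : coeffs R) (x t : R) : Prop :=
  2 * cos t * g13 p * g23 p * (cc p * g23 p - g13 p)
  = x * cc p * (g23 p ^+ 2 * g1 p - g13 p ^+ 2 * g2 p).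

(* Every solution of the equation for the angle is admitted; in the degenerate
   case the equation only involves [cos t], so both [t] and [- t] may occur. *)
Definition angle_for (R : realType) (p : coeffs R) (x t : R) : Prop :=
  [/\ angle_range t,
      A1 p x != 0 \/ A2 p x != 0 ->
        angle_eq p x t /\ B1 p x = B3 p x * sin t - B2 p x * cos t &
      A1 p x = 0 /\ A2 p x = 0 -> angle_eq_degenerate p x t].

(* Bases [(psi1, psi1p)] of [ker gamma2] and [(psi2, psi2p)] of [ker gamma1],
   the suffix [p] standing for the superscript "perp" *)
Record basis_pair (R : realType) (H : vectType R[i]) := BasisPair {
  psi1 : H; psi1p : H; psi2 : H; psi2p : H }.

Definition basis_pair_at (R : realType) (H : vectType R[i])
  (k11 k12 k21 k22 : H) (p : coeffs R) (x t : R) : basis_pair H :=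
  let c := cc p in
  let n1 := ((Num.sqrt (1 + x ^+ 2))^-1)%:C in
  let n2 := ((Num.sqrt (1 + c ^+ 2 * x ^+ 2))^-1)%:C in
  BasisPair
    (n1 *: (k21 + (x%:C * expi t) *: k22))
    (n1 *: ((x%:C * expi (- t)) *: k21 - k22))
    (n2 *: (- (x%:C * expi (- t) * c%:C) *: k11 + k12))
    (n2 *: (- k11 - (x%:C * expi t * c%:C) *: k12)).

Definition candidate (R : realType) (H : vectType R[i])
  (k11 k12 k21 k22 : H) (p : coeffs R) (b : basis_pair H) : Prop :=
  [\/ [/\ sin (phi p) = 0, cc p * g23 p = g13 p &
          b = BasisPair k21 k22 k12 k11],
      [/\ sin (phi p) = 0, cc p * g13 p = g23 p &
          b = BasisPair k22 k21 k11 k12] |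
      exists x t : R, [/\ nonzero_root p x, angle_for p x t &
          b = basis_pair_at k11 k12 k21 k22 p x t]].

Definition psi_inequalities (R : realType) (H : vectType R[i])
  (ip : {dot H for Num.conj}) (gamma1 gamma2 : 'End(H))
  (b : basis_pair H) : Prop :=
  braket ip (psi1p b) (gamma1 (psi1p b))
    <= `|braket ip (psi1p b) (psi2 b)| ^+ 2
       * braket ip (psi2 b) (gamma2 (psi2 b)) /\
  braket ip (psi2p b) (gamma2 (psi2p b))
    <= `|braket ip (psi2p b) (psi1 b)| ^+ 2
       * braket ip (psi1 b) (gamma1 (psi1 b)).

(* Main.v *)
(* Optimality is certified by a dual operator. If [Z] is positive, [Z - gamma1]
   is positive on [ker gamma2] and [Z - gamma2] is positive on [ker gamma1],
   then for every USD measurement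
     tr Z - success = tr (E1 (Z - gamma1)) + tr (E2 (Z - gamma2)) + tr (E? Z)
   is nonnegative. For [E1 = |psi1><psi1|], [E2 = |psi2><psi2|] the right-hand
   side can only vanish for
     Z = a |psi1><psi1| + d |psi2><psi2| + b |psi2><psi1| + b^* |psi1><psi2|
   with a = <psi1|gamma1|psi1>, d = <psi2|gamma2|psi2> and
     b = <psi1p|gamma1|psi1> / <psi1p|psi2>
       = (<psi2p|gamma2|psi2> / <psi2p|psi1>)^*.
   The second expression for [b] is what the equations for [x] and the angle
   say (imaginary and real part), and the two inequalities for the psi's say
   that [Z - gamma1] and [Z - gamma2] are positive on the kernels. Positivity of
   [Z] is then Cauchy-Schwarz for [gamma1]; it is strict as
   [ker gamma1] and [ker gamma2] meet trivially, so [Z] is invertible on the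
   span of [psi1] and [psi2]. An optimal measurement therefore has [E?]
   vanishing there, which forces [E1] and [E2]. Hence all candidates satisfying
   the inequalities share the ray of [psi1], which determines the candidate. *)
Require Import Defs.
From HB Require Import structures.
From mathcomp Require Import all_boot all_order all_algebra.
From mathcomp Require Import sesquilinear complex.
From mathcomp Require Import reals trigo.
From mathcomp Require Import ring lra zify.
Set Implicit Arguments.
Unset Strict Implicit.
Unset Printing Implicit Defensive.
Import Order.TTheory GRing.Theory Num.Theory.
Local Open Scope ring_scope.

(** Linear combination of equations: with the cofactor supplied by hand, the remaining identity is
    left to [ring]. *)
Lemma eq_of_mul_sub (S : comNzRingType) (k a b c d : S) :
  a = b -> c - d = k * (a - b) -> c = d.
Proof. by move=> -> /eqP; rewrite subrr mulr0 subr_eq0 => /eqP. Qed.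

Lemma eq_of_mul_sub2 (S : comNzRingType) (k l a b a' b' c d : S) :
  a = b -> a' = b' -> c - d = k * (a - b) + l * (a' - b') -> c = d.
Proof. by move=> -> -> /eqP; rewrite !subrr !mulr0 addr0 subr_eq0 => /eqP. Qed.

(** * Bra-ket calculus, the trace, and hermiticity of positive operators *)

Section Braket.
Variables (R : realType) (H : vectType R[i]) (ip : {dot H for Num.conj}).
Implicit Types (u v w : H) (a : R[i]) (A B F G : 'End(H)).
Local Notation "<[ u | v ]>" := (braket ip u v).

Lemma braketDr u v w : <[u | v + w]> = <[u | v]> + <[u | w]>.
Proof. exact: linearDl. Qed.

Lemma braketZr a u v : <[u | a *: v]> = a * <[u | v]>.
Proof. exact: linearZl_LR. Qed.

Lemma braketNr u v : <[u | - v]> = - <[u | v]>.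
Proof. exact: linearNl. Qed.

Lemma braketBr u v w : <[u | v - w]> = <[u | v]> - <[u | w]>.
Proof. exact: linearBl. Qed.

Lemma braket0r u : <[u | 0]> = 0.
Proof. exact: linear0l. Qed.

Lemma braket_sumr (I : Type) (r : seq I) (P : pred I) u (E : I -> H) :
  <[u | \sum_(i <- r | P i) E i]> = \sum_(i <- r | P i) <[u | E i]>.
Proof. exact: linear_sumlz. Qed.

Lemma braketC u v : <[v | u]> = <[u | v]>^*.
Proof. by rewrite /braket (hermC ip u v) /= expr0 mul1r. Qed.

Lemma braketDl u v w : <[u + v | w]> = <[u | w]> + <[v | w]>.
Proof. exact: linearDr. Qed.

Lemma braketZl a u v : <[a *: u | v]> = a^* * <[u | v]>.
Proof. exact: linearZr_LR. Qed.

Lemma braketNl u v : <[- u | v]> = - <[u | v]>.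
Proof. exact: linearNr. Qed.

Lemma braketBl u v w : <[u - v | w]> = <[u | w]> - <[v | w]>.
Proof. exact: linearBr. Qed.

Lemma braket_ge0 u : 0 <= <[u | u]>.
Proof. exact: dnorm_ge0. Qed.

Lemma braket_eq0 u : (<[u | u]> == 0) = (u == 0).
Proof. exact: dnorm_eq0. Qed.

Definition braketE :=
  (braketDr, braketDl, braketNr, braketNl, braketZr, braketZl).

Lemma ketbraE u v w : ketbra ip u v w = <[v | w]> *: u.
Proof. by rewrite lfunE. Qed.

Lemma comp_ketbra A u v : (A \o ketbra ip u v)%VF = ketbra ip (A u) v.
Proof.
by apply/lfunP => w; rewrite comp_lfunE !ketbraE linearZ.
Qed.

Lemma trlf_is_linear : linear (@trlf R H).
Proof. by move=> a A B; rewrite /trlf passmx.mxof_linear mxtraceD mxtraceZ. Qed.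
HB.instance Definition _ :=
  GRing.isLinear.Build R[i] 'End(H) R[i] *%R (@trlf R H) trlf_is_linear.

Lemma trlfC A B : trlf (A \o B)%VF = trlf (B \o A)%VF.
Proof.
by rewrite /trlf !(passmx.mxof_comp _ _ (vbasisP {:H})) mxtrace_mulC.
Qed.

Lemma trlf_ketbra u v : trlf (ketbra ip u v) = <[v | u]>.
Proof.
rewrite /trlf /mxtrace [in RHS](coord_vbasis (memvf u)) braket_sumr.
apply: eq_bigr => i _.
by rewrite mxE /= mxE /= passmx.vecof_delta ketbraE braketZr linearZ mulrC.
Qed.

Lemma trlf_comp_ketbra A u v : trlf (A \o ketbra ip u v)%VF = <[v | A u]>.
Proof. by rewrite comp_ketbra trlf_ketbra. Qed.

Section PSD.
Variables (A : 'End(H)) (Apsd : psd ip A).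

(** Polarization: the form of [A] is real at [u + v] and at [u + 'i *: v], which makes
    [<u|Av>^* - <v|Au>] equal to its own negative. *)
Lemma psd_herm u v : <[v | A u]> = <[u | A v]>^*.
Proof.
have realA w : <[w | A w]> = <[w | A w]>^* by rewrite geC0_conj.
have h1 := realA (u + v).
have hi := realA (u + 'i *: v).
rewrite !(linearD, linearZ) /= !braketE in h1 hi.
rewrite !(rmorphD, rmorphM) /= in h1 hi.
rewrite -!realA in h1 hi.
rewrite !conjCK conjCi in hi.
have e1 : <[u | A v]> - <[v | A u]>^* = <[u | A v]>^* - <[v | A u]>.
  by apply: (eq_of_mul_sub (k := 1) h1); ring.
have e2 : <[u | A v]> - <[v | A u]>^* = - (<[u | A v]>^* - <[v | A u]>).
  by apply: (mulfI (neq0Ci R[i])); apply: (eq_of_mul_sub (k := 1) hi); ring.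
have e3 : <[u | A v]>^* - <[v | A u]> = 0.
  by apply/eqP; rewrite -eqNr -e2 e1.
by apply/esym/eqP; rewrite -subr_eq0 e3.
Qed.

End PSD.
End Braket.

(** * Positive operators *)

Section PositiveSemidefinite.
Variables (R : realType) (H : vectType R[i]) (ip : {dot H for Num.conj}).
Implicit Types (u v w : H) (a : R[i]) (A B F G : 'End(H)).
Local Notation "<[ u | v ]>" := (braket ip u v).

Lemma lkerP A u : reflect (A u = 0) (u \in lker A).
Proof. by rewrite memv_ker; apply: eqP. Qed.

Lemma psd_real A u : psd ip A -> <[u | A u]>^* = <[u | A u]>.
Proof. by move=> Apsd; rewrite geC0_conj. Qed.

Lemma psd_line A u v a : psd ip A ->
  <[u + a *: v | A (u + a *: v)]> =
  <[u | A u]> + (a * <[u | A v]> + (a * <[u | A v]>)^*)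
  + a * a^* * <[v | A v]>.
Proof.
move=> Apsd; rewrite !(linearD, linearZ) /= !braketE (psd_herm Apsd u v).
by rewrite rmorphM; ring.
Qed.

(** [w] minimises the form of [A] on the line through [u] in direction [v]; the minimum is a Schur
    complement. *)
Lemma psd_line_opt A u v : psd ip A -> <[v | A v]> != 0 ->
  let w := u - (<[u | A v]>^* / <[v | A v]>) *: v in
  <[w | A w]> = <[u | A u]> - `|<[u | A v]>| ^+ 2 / <[v | A v]>.
Proof.
move=> Apsd s0 /=; rewrite -scaleNr psd_line // normCK.
rewrite !(rmorphM, rmorphN, fmorphV) /= conjCK psd_real //.
by field.
Qed.

Lemma psd_CauchySchwarz A u v : psd ip A ->
  `|<[u | A v]>| ^+ 2 <= <[u | A u]> * <[v | A v]>.
Proof.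
move=> Apsd; have [s0|s0] := eqVneq <[v | A v]> 0; last first.
  have s_gt0 : 0 < <[v | A v]> by rewrite lt_def s0 Apsd.
  rewrite -ler_pdivrMr // -subr_ge0 -psd_line_opt //; exact: Apsd.
rewrite s0 mulr0; have [->|t0] := eqVneq <[u | A v]> 0.
  by rewrite normr0 expr0n.
have r_ge0 : 0 <= <[u | A u]> by apply: Apsd.
(* If [v] is isotropic but [<u|Av>] is not zero, the form is unbounded below along [v]; this
   multiple of [v] gives the value [- (<u|Au> + 2)]. *)
have := Apsd (u + (- (<[u | A u]> + 1) / <[u | A v]>) *: v).
rewrite psd_line // s0 mulr0 addr0 mulfVK // rmorphN rmorphD rmorph1 /=.
rewrite (psd_real _ Apsd) => h.
have r2_gt0 : 0 < <[u | A u]> + 2 by rewrite ltr_wpDl ?ltr0n.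
suff : 0 <= - (<[u | A u]> + 2) by rewrite oppr_ge0 lt_geF.
rewrite (_ : - _ =
  <[u | A u]> + (- (<[u | A u]> + 1) - (<[u | A u]> + 1))) //; ring.
Qed.

Lemma psd_ker A u : psd ip A -> <[u | A u]> = 0 -> A u = 0.
Proof.
move=> Apsd u0; have := psd_CauchySchwarz (A u) u Apsd.
rewrite u0 mulr0 => h; apply/eqP; rewrite -(braket_eq0 ip) -normr_eq0.
by rewrite -sqrf_eq0 eq_le h exprn_ge0.
Qed.

Lemma psd_ketbra u : psd ip (ketbra ip u u).
Proof.
by move=> w; rewrite ketbraE braketZr (braketC ip u w) -normCK exprn_ge0.
Qed.

(* Cholesky: subtracting [|Av><Av| / <v|Av>] keeps [A] positive and adds [v] to
   its kernel. *)
Lemma psd_sum_ketbra A : psd ip A ->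
  exists s : seq H, A = \sum_(u <- s) ketbra ip u u.
Proof.
have [n] := ubnP (\dim {:H} - \dim (lker A)).
elim: n A => // n IHn A ltn Apsd.
have [full|/subvPn[v _]] := boolP ({:H} <= lker A)%VS.
  exists [::]; rewrite big_nil; apply/lfunP => w; rewrite lfunE /=.
  by apply/eqP; rewrite -memv_ker (subvP full) // memvf.
rewrite memv_ker => Av0.
have s0 : <[v | A v]> != 0 by apply: contra_neq Av0; apply: psd_ker.
have s_ge0 : 0 <= <[v | A v]> by apply: Apsd.
pose u := (sqrtC <[v | A v]>)^-1 *: A v.
have uE w : ketbra ip u u w = (<[A v | w]> / <[v | A v]>) *: A v.
  rewrite ketbraE braketZl scalerA geC0_conj ?invr_ge0 ?sqrtC_ge0 //.
  congr (_ *: _); rewrite mulrAC -invfM -expr2 sqrtCK mulrC //.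
have vAE w : <[A v | w]> = <[v | A w]>.
  by rewrite (braketC ip w) (psd_herm Apsd w v).
have [A' A'def] : exists A', A' = A - ketbra ip u u by eexists.
have A'E w : A' w = A w - (<[A v | w]> / <[v | A v]>) *: A v.
  by rewrite A'def lfunE /= lfunE /= uE.
have A'psd : psd ip A'.
  move=> w; rewrite A'E braketBr braketZr vAE subr_ge0.
  rewrite mulrAC ler_pdivrMr ?lt_def ?s0 //.
  by rewrite (psd_herm Apsd w v) mulrC -normCK psd_CauchySchwarz.
have ker_lt : (\dim (lker A) < \dim (lker A'))%N.
  have sub : (lker A <= lker A')%VS.
    apply/subvP => w /lkerP Aw0; apply/lkerP.
    by rewrite (A'E w) (vAE w) Aw0 braket0r mul0r scale0r subr0.
  rewrite ltnNge (geq_leqif (dimv_leqif_sup sub)); apply/subvPn; exists v.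
    by apply/lkerP; rewrite (A'E v) (vAE v) divff // scale1r subrr.
  by apply: contraNN Av0 => /lkerP /eqP.
have [|s As] := IHn A' _ A'psd.
  have := dimvS (subvf (lker A')); lia.
exists (u :: s); rewrite big_cons -As A'def addrC subrK //.
Qed.

Lemma trlf_sum_ketbra_comp (s : seq H) A :
  trlf ((\sum_(u <- s) ketbra ip u u) \o A)%VF = \sum_(u <- s) <[u | A u]>.
Proof.
rewrite trlfC; elim: s => [|u s IHs].
  by rewrite !big_nil comp_lfun0r linear0.
by rewrite !big_cons comp_lfunDr linearD /= trlf_comp_ketbra IHs.
Qed.

Lemma trlf_comp_ge0 F B : psd ip F -> psd ip B -> 0 <= trlf (F \o B)%VF.
Proof.
move=> /psd_sum_ketbra[s ->] Bpsd; rewrite trlf_sum_ketbra_comp.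
by apply: sumr_ge0 => u _; apply: Bpsd.
Qed.

(** With [A] a sum of [|u><u|], the trace is a sum of terms [<u|Bu> >= 0]. All of them vanish, so
    [B u = 0], and by hermiticity every [<u|Bw>] is zero. *)
Lemma trlf_comp_psd_eq0 A B : psd ip A -> psd ip B -> trlf (A \o B)%VF = 0 ->
  (A \o B)%VF = 0.
Proof.
move=> /psd_sum_ketbra[s ->] Bpsd; rewrite trlf_sum_ketbra_comp => /eqP.
rewrite psumr_eq0; last by move=> u _; apply: Bpsd.
move=> /allP s0; apply/lfunP => w; rewrite comp_lfunE sum_lfunE lfunE /=.
rewrite big_seq big1 // => u /s0 /= /eqP /(psd_ker Bpsd) Bu0.
by rewrite ketbraE (psd_herm Bpsd w u) Bu0 braket0r conjC0 scale0r.
Qed.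

(** The vanishing trace puts every [u] of a decomposition of [F] into [|u><u|] in the kernel of [G].
    This is why the dual constraints are needed only on the kernels. *)
Lemma trlf_comp_ker_ge0 F G B : psd ip F -> psd ip G ->
  trlf (F \o G)%VF = 0 -> (forall w, G w = 0 -> 0 <= <[w | B w]>) ->
  0 <= trlf (F \o B)%VF.
Proof.
move=> /psd_sum_ketbra[s ->] Gpsd; rewrite !trlf_sum_ketbra_comp => /eqP.
rewrite psumr_eq0; last by move=> u _; apply: Gpsd.
move=> /allP s0 B_ge0; rewrite big_seq; apply: sumr_ge0 => u /s0 /= /eqP.
by move=> /(psd_ker Gpsd) /B_ge0.
Qed.

End PositiveSemidefinite.

(** * The dual certificate *)

Section Certificate.
Variables (R : realType) (H : vectType R[i]) (ip : {dot H for Num.conj}).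
Implicit Types (u v w p q : H) (a b d : R[i]) (A F G : 'End(H)).
Local Notation "<[ u | v ]>" := (braket ip u v).

Lemma trlfD A F : trlf (A + F) = trlf A + trlf F.
Proof. exact: linearD. Qed.

Lemma trlfN A : trlf (- A) = - trlf A.
Proof. exact: raddfN. Qed.

Definition onb_ker G p p' : Prop :=
  [/\ G p = 0 /\ G p' = 0, [/\ <[p | p]> = 1, <[p' | p']> = 1 & <[p | p']> = 0]
    & forall w, G w = 0 -> w = <[p | w]> *: p + <[p' | w]> *: p'].

(** The operator [Z] of the overview, with [p], [q] in the roles of [psi1], [psi2]. *)
Definition dual_op p q a d b : 'End(H) :=
  a *: ketbra ip p p + d *: ketbra ip q q
  + (b *: ketbra ip q p + b^* *: ketbra ip p q).

Lemma dual_opC p q a d b : dual_op q p d a b^* = dual_op p q a d b.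
Proof.
by rewrite /dual_op conjCK [d *: _ + _]addrC [b^* *: _ + _]addrC.
Qed.

Lemma dual_opE p q a d b w : dual_op p q a d b w =
  (a * <[p | w]> + b^* * <[q | w]>) *: p
  + (d * <[q | w]> + b * <[p | w]>) *: q.
Proof.
rewrite /dual_op !add_lfunE !scale_lfunE.
rewrite !ketbraE !scalerA !scalerDl -!addrA; congr (_ + _).
by rewrite addrCA addrC -addrA addrCA.
Qed.

Lemma braket_dual_op p q a d b w : <[w | dual_op p q a d b w]> =
  a * (<[p | w]> * <[p | w]>^*) + d * (<[q | w]> * <[q | w]>^*)
  + (b * <[p | w]> * <[q | w]>^* + b^* * <[q | w]> * <[p | w]>^*).
Proof.
by rewrite dual_opE !braketE (braketC ip p w) (braketC ip q w); ring.
Qed.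

(** Completing the square: with [x = <p|w>] and [y = <q|w>], [a] times the form is
    [|a x + b^* y|^2 + (a d - |b|^2) |y|^2]. *)
Lemma dual_op_psd p q a d b : 0 < a -> b * b^* < a * d ->
  psd ip (dual_op p q a d b).
Proof.
move=> a_gt0 det_gt0 w; rewrite braket_dual_op.
rewrite -(pmulr_rge0 _ a_gt0).
set x := <[p | w]>; set y := <[q | w]>.
have aC : a^* = a by rewrite geC0_conj // ltW.
rewrite [X in 0 <= X](_ : _ = (a * x + b^* * y) * (a * x + b^* * y)^* +
    (a * d - b * b^*) * (y * y^*)); last first.
  by rewrite rmorphD !rmorphM /= conjCK aC; ring.
rewrite -!normCK addr_ge0 ?exprn_ge0 // mulr_ge0 ?exprn_ge0 //.
by rewrite normCK subr_ge0 ltW.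
Qed.

Lemma trlf_dual_op p q a d b : <[p | p]> = 1 -> <[q | q]> = 1 ->
  <[p | q]> = 0 -> trlf (dual_op p q a d b) = a + d.
Proof.
move=> pp qq pq; rewrite /dual_op !linearD !linearZ /= !trlf_ketbra pp qq.
by rewrite (braketC ip p q) pq conjC0 !mulr0 !addr0 !mulr1.
Qed.

(** In the basis [p], [p'] of the kernel, the choice of [a] cancels the diagonal entry of [Z - A] at
    [p] and the choice of [b] cancels the off-diagonal ones. Only the entry at [p'] is left, and the
    inequality makes it nonnegative. *)
Lemma dual_op_ker_ge0 A G p p' q d b : psd ip A -> onb_ker G p p' ->
  <[p | q]> = 0 -> b * <[p' | q]> = <[p' | A p]> -> d^* = d ->
  <[p' | A p']> <= `|<[p' | q]>| ^+ 2 * d ->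
  forall w, G w = 0 ->
    0 <= <[w | (dual_op p q <[p | A p]> d b - A) w]>.
Proof.
move=> Apsd [[Gp Gp'] [pp p'p' pp'] Gbasis] pq bE dC ineq w /Gbasis.
set x := <[p | w]>; set y := <[p' | w]> => wE.
have qw : <[q | w]> = y * <[p' | q]>^*.
  rewrite wE !braketE (braketC ip p q) pq conjC0 mulr0 add0r.
  by rewrite (braketC ip p' q).
have -> : <[w | (dual_op p q <[p | A p]> d b - A) w]> =
    y * y^* * (`|<[p' | q]>| ^+ 2 * d - <[p' | A p']>).
  rewrite add_lfunE opp_lfunE braketBr braket_dual_op -/x qw {2}wE.
  rewrite [in X in _ - X]wE linearD !linearZ /= !braketE.
  rewrite (psd_herm Apsd p' p) -bE normCK !rmorphM /= !conjCK; ring.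
by rewrite -normCK mulr_ge0 ?exprn_ge0 // subr_ge0.
Qed.

(** Strict Cauchy-Schwarz: equality would put [p'] minus a multiple of [p], a nonzero vector of the
    kernel of [G], into the kernel of [A]. *)
Lemma onb_ker_det A G p p' : psd ip A ->
  (forall w, A w = 0 -> G w = 0 -> w = 0) -> onb_ker G p p' ->
  0 < <[p | A p]> /\
  `|<[p' | A p]>| ^+ 2 < <[p' | A p']> * <[p | A p]>.
Proof.
move=> Apsd AG0 [[Gp Gp'] [pp p'p' pp'] _].
have pA_neq0 : <[p | A p]> != 0.
  apply/eqP => /(psd_ker Apsd) /AG0 /(_ Gp) p0.
  by move/eqP: pp; rewrite p0 braket0r eq_sym oner_eq0.
have pA_gt0 : 0 < <[p | A p]> by rewrite lt_def pA_neq0 Apsd.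
split=> //; rewrite -ltr_pdivrMr // -subr_gt0 -psd_line_opt //.
rewrite lt_def Apsd andbT; apply/eqP => /(psd_ker Apsd) /AG0 w0.
have : <[p' | p' - (<[p' | A p]>^* / <[p | A p]>) *: p]> = 0.
  by rewrite w0 ?braket0r // linearB linearZ /= Gp Gp' scaler0 subr0.
rewrite braketBr braketZr p'p' (braketC ip p p') pp' conjC0 mulr0 subr0.
by move/eqP; rewrite oner_eq0.
Qed.

Variables (G1 G2 : 'End(H)).
Hypotheses (G1psd : psd ip G1) (G2psd : psd ip G2).
Hypothesis ker_ker : forall w, G1 w = 0 -> G2 w = 0 -> w = 0.
Variables p p' q q' : H.
Hypotheses (onbp : onb_ker G2 p p') (onbq : onb_ker G1 q q').
Hypothesis pq : <[p | q]> = 0.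
Hypotheses (p'q : <[p' | q]> != 0) (q'p : <[q' | p]> != 0).
Hypothesis balance :
  <[p' | G1 p]> / <[p' | q]> = (<[q' | G2 q]> / <[q' | p]>)^*.
Hypothesis ineqp :
  <[p' | G1 p']> <= `|<[p' | q]>| ^+ 2 * <[q | G2 q]>.
Hypothesis ineqq :
  <[q' | G2 q']> <= `|<[q' | p]>| ^+ 2 * <[p | G1 p]>.

Let a := <[p | G1 p]>.
Let d := <[q | G2 q]>.
Let b := <[p' | G1 p]> / <[p' | q]>.
Let Z := dual_op p q a d b.

Let pp : <[p | p]> = 1. Proof. by case: onbp => _ []. Qed.
Let qq : <[q | q]> = 1. Proof. by case: onbq => _ []. Qed.
Let qp : <[q | p]> = 0. Proof. by rewrite (braketC ip p q) pq conjC0. Qed.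
Let G2p : G2 p = 0. Proof. by case: onbp => - []. Qed.
Let G1q : G1 q = 0. Proof. by case: onbq => - []. Qed.

(** Strict Cauchy-Schwarz for [G1] bounds the numerator of [|b|^2] by [a <p'|G1 p'>]; then [ineqp]
    replaces [<p'|G1 p'>] by [|<p'|q>|^2 d]. *)
Lemma dual_op_det : b * b^* < a * d.
Proof.
have [_ lt_t] := onb_ker_det G1psd ker_ker onbp.
have a_gt0 : 0 < a by case: (onb_ker_det G1psd ker_ker onbp).
have s_gt0 : 0 < `|<[p' | q]>| ^+ 2 by rewrite exprn_gt0 // normr_gt0.
rewrite -normCK /b normrM normfV exprMn exprVn ltr_pdivrMr //.
apply: lt_le_trans lt_t _.
by rewrite mulrC -mulrA ler_pM2l // mulrC.
Qed.

Lemma dual_psd : psd ip Z.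
Proof.
apply: dual_op_psd dual_op_det.
by case: (onb_ker_det G1psd ker_ker onbp).
Qed.

Lemma dual_ge1 w : G2 w = 0 -> 0 <= <[w | (Z - G1) w]>.
Proof.
apply: (dual_op_ker_ge0 G1psd onbp pq _ (psd_real q G2psd) ineqp).
by rewrite mulfVK.
Qed.

(** By [balance], [b^*] is the off-diagonal coefficient required on the second kernel, so the same
    argument applies with the two states exchanged. *)
Lemma dual_ge2 w : G1 w = 0 -> 0 <= <[w | (Z - G2) w]>.
Proof.
rewrite /Z -dual_opC /b balance conjCK.
apply: (dual_op_ker_ge0 G2psd onbq qp _ (psd_real p G1psd) ineqq).
by rewrite mulfVK.
Qed.

Lemma success_dual F1 F2 Fq : F1 + F2 + Fq = \1%VF ->
  a + d - success G1 G2 F1 F2 =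
  trlf (F1 \o (Z - G1))%VF + trlf (F2 \o (Z - G2))%VF + trlf (Fq \o Z)%VF.
Proof.
move=> F1q; rewrite -(trlf_dual_op a d b pp qq pq) -/Z.
rewrite -[in LHS](comp_lfun1l Z) -F1q !comp_lfunDl !comp_lfunDr.
rewrite !comp_lfunNr !trlfD !trlfN /success; ring.
Qed.

Lemma success_le F1 F2 Fq : is_usd ip G1 G2 F1 F2 Fq ->
  success G1 G2 F1 F2 <= a + d.
Proof.
case=> [[F1psd F2psd Fqpsd] [F1q F2G1 F1G2]].
rewrite -subr_ge0 (success_dual F1q) !addr_ge0 //.
- exact: trlf_comp_ker_ge0 F1psd G2psd F1G2 dual_ge1.
- exact: trlf_comp_ker_ge0 F2psd G1psd F2G1 dual_ge2.
- exact: trlf_comp_ge0 Fqpsd dual_psd.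
Qed.

(** Complementary slackness: a zero duality gap forces [Fq Z = 0]. Evaluated at [p] and [q] this is
    a linear system for [Fq p] and [Fq q] with determinant [a d - |b|^2], nonzero by
    [dual_op_det]. *)
Lemma success_eq F1 F2 Fq : is_usd ip G1 G2 F1 F2 Fq ->
  success G1 G2 F1 F2 = a + d -> Fq p = 0 /\ Fq q = 0.
Proof.
case=> [[F1psd F2psd Fqpsd] [F1q F2G1 F1G2]] Fad.
have := success_dual F1q; rewrite Fad subrr => /esym/eqP.
have ge1 := trlf_comp_ker_ge0 F1psd G2psd F1G2 dual_ge1.
have ge2 := trlf_comp_ker_ge0 F2psd G1psd F2G1 dual_ge2.
have ge3 := trlf_comp_ge0 Fqpsd dual_psd.
rewrite paddr_eq0 ?addr_ge0 // => /andP[_ /eqP].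
move=> /(trlf_comp_psd_eq0 Fqpsd dual_psd) FqZ.
have FZ w : Fq (Z w) = 0 by rewrite -comp_lfunE FqZ lfunE.
have FZp : a *: Fq p + b *: Fq q = 0.
  rewrite -[RHS](FZ p) dual_opE pp qp !mulr1 !mulr0 addr0 add0r.
  by rewrite linearD !linearZ.
have FZq : b^* *: Fq p + d *: Fq q = 0.
  rewrite -[RHS](FZ q) dual_opE qq pq !mulr1 !mulr0 addr0 add0r.
  by rewrite linearD !linearZ.
have det0 : a * d - b * b^* != 0 by rewrite subr_eq0 gt_eqF // dual_op_det.
split; apply/eqP.
(* Cramer's rule: [d] times the first relation minus [b] times the second eliminates [Fq q]. *)
- rewrite -(inj_eq (scalerI det0)) scaler0; apply/eqP.
  rewrite -[RHS](subrr 0) -[X in _ = X - _](scaler0 _ d) -{1}FZp.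
  rewrite -[X in _ = _ - X](scaler0 _ b) -FZq !scalerDr !scalerA.
  by rewrite opprD addrACA [b * d]mulrC subrr addr0 scalerBl [d * a]mulrC.
- rewrite -(inj_eq (scalerI det0)) scaler0; apply/eqP.
  rewrite -[RHS](subrr 0) -[X in _ = X - _](scaler0 _ a) -{1}FZq.
  rewrite -[X in _ = _ - X](scaler0 _ b^*) -FZp !scalerDr !scalerA.
  rewrite opprD addrACA [b^* * a]mulrC subrr add0r scalerBl.
  by rewrite [b^* * b]mulrC.
Qed.

(** [F w] lies in the span of [u] and [u']. By hermiticity [F u = u] fixes its [u]-component as
    [<u|w>], and [F v = 0] makes it orthogonal to [v], which kills the [u']-component. *)
Lemma psd_ketbra_of_ker F G u u' v : psd ip F -> onb_ker G u u' ->
  <[u' | v]> != 0 -> <[u | v]> = 0 -> (forall w, G (F w) = 0) ->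
  F u = u -> F v = 0 -> F = ketbra ip u u.
Proof.
move=> Fpsd [_ _ Gbasis] u'v uv GF Fu Fv; apply/lfunP => w; rewrite ketbraE.
have Fw := Gbasis _ (GF w).
have uF : <[u | F w]> = <[u | w]>.
  by rewrite (psd_herm Fpsd w u) Fu -(braketC ip w u).
have : <[v | F w]> = 0 by rewrite (psd_herm Fpsd w v) Fv braket0r conjC0.
rewrite Fw uF !braketE (braketC ip u v) uv conjC0 mulr0 add0r => /eqP.
rewrite mulf_eq0 (braketC ip u' v) conjC_eq0 (negPf u'v) orbF => /eqP ->.
by rewrite scale0r addr0.
Qed.

Lemma usd_range F1 F2 Fq : is_usd ip G1 G2 F1 F2 Fq ->
  (forall w, G2 (F1 w) = 0) /\ (forall w, G1 (F2 w) = 0).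
Proof.
case=> [[F1psd F2psd Fqpsd] [_ F2G1 F1G2]].
rewrite trlfC in F2G1; rewrite trlfC in F1G2.
have e1 := trlf_comp_psd_eq0 G2psd F1psd F1G2.
have e2 := trlf_comp_psd_eq0 G1psd F2psd F2G1.
by split=> w; rewrite -comp_lfunE ?e1 ?e2 lfunE.
Qed.

Lemma usd_ketbra :
  is_usd ip G1 G2 (ketbra ip p p) (ketbra ip q q)
    (\1%VF - ketbra ip p p - ketbra ip q q).
Proof.
split; split; try exact: psd_ketbra.
- move=> w; rewrite !add_lfunE !opp_lfunE id_lfunE !ketbraE.
  (* The complement of two orthogonal rank-one projections is a projection [P], so
     [<w|Pw> = <Pw|Pw>]. *)
  rewrite (_ : <[w | _]> = <[w - <[p | w]> *: p - <[q | w]> *: q |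
                           w - <[p | w]> *: p - <[q | w]> *: q]>).
    exact: braket_ge0.
  rewrite !(braketBl, braketBr, braketZl, braketZr) pp qq pq qp.
  by rewrite (braketC ip p w) (braketC ip q w); ring.
- by rewrite -[_ - _ - _]addrA -opprD addrCA subrr addr0.
- rewrite trlfC trlf_comp_ketbra G1q braket0r //.
- rewrite trlfC trlf_comp_ketbra G2p braket0r //.
Qed.

Lemma success_ketbra :
  success G1 G2 (ketbra ip p p) (ketbra ip q q) = a + d.
Proof. by rewrite /success !(trlfC (ketbra _ _ _)) !trlf_comp_ketbra. Qed.

(** An optimal measurement attains the dual bound, so [Eq] vanishes at [p] and [q], where [E1 + E2]
    then acts as the identity. Since [E1] and [E2] map into kernels with trivial intersection, [E1]
    takes all of [p] and [E2] all of [q]. *)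
Theorem optimal_usd_ketbra E1 E2 Eq :
  is_optimal_usd ip G1 G2 E1 E2 Eq <->
  [/\ E1 = ketbra ip p p, E2 = ketbra ip q q & Eq = \1%VF - E1 - E2].
Proof.
split=> [[Eusd Emax]|[-> -> ->]]; last first.
  split=> [|F1 F2 Fq]; first exact: usd_ketbra.
  by rewrite success_ketbra; apply: success_le.
have Ead : success G1 G2 E1 E2 = a + d.
  apply/le_anti; rewrite (success_le Eusd) -success_ketbra.
  by rewrite (Emax _ _ _ usd_ketbra).
have [Eqp Eqq] := success_eq Eusd Ead.
have [G2E1 G1E2] := usd_range Eusd.
case: Eusd => [[E1psd E2psd Eqpsd] [E1q _ _]].
have sumE w : Eq w = 0 -> E1 w + E2 w = w.
  move=> Eqw; rewrite -[RHS](id_lfunE w) -E1q !add_lfunE Eqw addr0 //.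
have E2p : E2 p = 0.
  (* [E2 p] lies in the kernel of [G1] by its range, and in that of [G2] because it equals
     [p - E1 p]. *)
  apply: ker_ker => //; have /eqP := sumE _ Eqp.
  rewrite addrC eq_sym -subr_eq => /eqP <-.
  by rewrite linearB /= G2p G2E1 subr0.
have E1qq : E1 q = 0.
  apply: ker_ker => //; have /eqP := sumE _ Eqq.
  rewrite eq_sym -subr_eq => /eqP <-.
  by rewrite linearB /= G1q G1E2 subr0.
have E1p : E1 p = p by rewrite -[RHS](sumE _ Eqp) E2p addr0.
have E2q : E2 q = q by rewrite -[RHS](sumE _ Eqq) E1qq add0r.
split.
- exact: psd_ketbra_of_ker E1psd onbp p'q pq G2E1 E1p E1qq.
- exact: psd_ketbra_of_ker E2psd onbq q'p qp G1E2 E2q E2p.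
- by rewrite -E1q -[_ - _ - _]addrA -opprD [_ + Eq]addrC addrK.
Qed.

End Certificate.

(** * The equations for the angle *)

Section Angle.
Variable R : realType.
Implicit Types (p : coeffs R) (x t a b : R).

Lemma sin_eq0_pi t : - pi < t < pi -> sin t = 0 -> t = 0.
Proof.
move=> /andP[t_gt t_lt] st0; have [t0|t0|//] := ltgtP t 0.
  have := @sin_gt0_pi R (- t); rewrite sinN st0 oppr0 ltxx.
  by rewrite oppr_gt0 t0 ltrNl t_gt => /(_ isT).
by have := @sin_gt0_pi R t; rewrite st0 ltxx t0 t_lt => /(_ isT).
Qed.

(** Two solutions satisfy [sin (t - t') = 0], and the half-open range has length [pi], so they
    coincide. *)
Lemma exists_unique_angle a b : a != 0 \/ b != 0 ->
  exists! t : R, angle_range t /\ a * sin t = b * cos t.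
Proof.
move=> ab0.
have [t [tr te]] : exists t, angle_range t /\ a * sin t = b * cos t.
  have [a0|a0] := eqVneq a 0.
    exists (- (pi / 2)); rewrite cosN cos_pihalf a0 mul0r mulr0; split=> //.
    rewrite /angle_range lexx /=; have := pi_gt0 R; lra.
  have lt1 := @atan_gtNpi2 R (b / a); have lt2 := @atan_ltpi2 R (b / a).
  exists (atan (b / a)); rewrite /angle_range ltW //=; split=> //.
  have c0 : cos (atan (b / a)) != 0 by rewrite gt_eqF // cos_gt0_pihalf // lt1.
  have := atanK (b / a); rewrite /tan => /(canRL (mulfVK c0)) ->.
  by rewrite mulrA mulrCA mulfV // mulr1.
exists t; split=> // t' [tr' te'].
have st : sin (t - t') = 0.
  rewrite sinB; apply/eqP; case: ab0 => ab0; rewrite -(mulrI_eq0 _ (lregP ab0)).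
    apply/eqP; rewrite mulrBr !mulrA te.
    by rewrite -[a * cos t * sin t']mulrAC te'; ring.
  apply/eqP; rewrite mulrBr !mulrA.
  by rewrite [b * sin t * cos t']mulrAC -te' -te; ring.
move/andP: tr => [? ?]; move/andP: tr' => [? ?].
by apply/eqP; rewrite -subr_eq0; apply/eqP/sin_eq0_pi => //; lra.
Qed.

Section Coeffs.
Variable p : coeffs R.
Hypotheses (c_gt0 : 0 < cc p) (phi_range : 0 <= phi p < pi).
Hypothesis phi0 : g13 p = 0 \/ g23 p = 0 -> phi p = 0.
Hypotheses (g13_ge0 : 0 <= g13 p) (g23_ge0 : 0 <= g23 p).
Hypothesis c1 : cc p = 1 -> g13 p = 0.

Lemma sqr_add1_neq0 x : x ^+ 2 + 1 != 0.
Proof. by rewrite gt_eqF // ltr_wpDl ?sqr_ge0. Qed.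

(** [A2] is a sum of nonnegative terms times [sin (phi p)], so [A2 = 0] leaves only [phi p = 0]. If
    [c g23 = g13], then [A1 = 0] would give [c = 1], where [c1] makes [g13] vanish. Hence the factor
    of [cos t] in the degenerate equation is nonzero. *)
Lemma degenerate_coeffs x : nonzero_root p x -> A1 p x = 0 -> A2 p x = 0 ->
  [/\ g13 p != 0, g23 p != 0, phi p = 0, cc p * g23 p != g13 p &
      cc p * (x ^+ 2 + 1) * g23 p = (x ^+ 2 * cc p ^+ 2 + 1) * g13 p].
Proof.
case=> g0 x0 _; rewrite /A1 /A2 => a1 a2.
have u0 : x ^+ 2 * cc p ^+ 2 + 1 != 0 by rewrite -exprMn sqr_add1_neq0.
have v0 := sqr_add1_neq0 x.
have cn0 : cc p != 0 by rewrite gt_eqF.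
have phi_eq0 : phi p = 0.
  have [g10|g10] := eqVneq (g13 p) 0; first by apply: phi0; left.
  have [s0|s0] := eqVneq (sin (phi p)) 0.
    apply: sin_eq0_pi s0; move/andP: phi_range => [? ?].
    by have := pi_gt0 R; lra.
  move: a2 => /eqP; rewrite mulf_eq0 (negPf s0) orbF => /eqP a2.
  have : (x ^+ 2 * cc p ^+ 2 + 1) * g13 p = 0.
    have c_ge0 := ltW c_gt0.
    have v_ge0 : 0 <= x ^+ 2 + 1 by rewrite addr_ge0 ?sqr_ge0.
    have u_ge0 : 0 <= x ^+ 2 * cc p ^+ 2 + 1.
      by rewrite -exprMn addr_ge0 ?sqr_ge0.
    have : 0 <= cc p * (x ^+ 2 + 1) * g23 p by rewrite !mulr_ge0.
    have : 0 <= (x ^+ 2 * cc p ^+ 2 + 1) * g13 p by rewrite mulr_ge0.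
    by lra.
  by move/eqP; rewrite mulf_eq0 (negPf u0) (negPf g10).
move: a1; rewrite phi_eq0 cos0 mulr1 => /eqP; rewrite subr_eq0 => /eqP uv.
have g130 : g13 p != 0.
  apply/eqP => g10; move/eqP: uv; rewrite g10 mulr0 !mulf_eq0.
  rewrite (negPf cn0) (negPf v0) /= => /eqP g20.
  by case: g0; rewrite ?g10 ?g20 eqxx.
have g230 : g23 p != 0.
  apply: contraNneq g130 => g20; move/eqP: uv; rewrite g20 mulr0 eq_sym.
  by rewrite mulf_eq0 (negPf u0).
split=> //; apply/eqP => cg.
have cg0 : cc p * g23 p != 0 by rewrite mulf_neq0.
have {}uv : x ^+ 2 + 1 = x ^+ 2 * cc p ^+ 2 + 1.
  by apply: (mulIf cg0); rewrite {2}cg -uv; ring.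
have /eqP : x ^+ 2 * (cc p ^+ 2 - 1) = 0.
  by apply: (eq_of_mul_sub (k := -1) uv); ring.
rewrite mulf_eq0 sqrf_eq0 (negPf x0) /= subr_eq0 sqrf_eq1.
have -> : (cc p == -1) = false by rewrite gt_eqF // (lt_trans _ c_gt0) ?ltrN10.
by rewrite orbF => /eqP /c1 /eqP; rewrite (negPf g130).
Qed.

Lemma degenerate_cos_unique x t t' : nonzero_root p x ->
  A1 p x = 0 -> A2 p x = 0 ->
  angle_eq_degenerate p x t -> angle_eq_degenerate p x t' -> cos t = cos t'.
Proof.
move=> rx a1 a2; have [g10 g20 _ cg _] := degenerate_coeffs rx a1 a2.
rewrite /angle_eq_degenerate => <-.
have k0 : 2 * g13 p * g23 p * (cc p * g23 p - g13 p) != 0.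
  by rewrite !mulf_neq0 ?subr_eq0 // pnatr_eq0.
by move=> e; apply: (mulfI k0); apply: (eq_of_mul_sub (k := -1) e); ring.
Qed.

(** The addition formulas turn the angle equation into the imaginary part of the balance condition.
    If [A1 = A2 = 0], the angle equation holds trivially. *)
Lemma angle_for_im x t : angle_for p x t ->
  (x ^+ 2 * cc p ^+ 2 + 1) * g13 p * sin (t + phi p) =
  cc p * (x ^+ 2 + 1) * g23 p * sin (t - phi p).
Proof.
case=> _ nondeg _.
have : angle_eq p x t.
  have [a1|a1] := eqVneq (A1 p x) 0; last by case: nondeg => //; left.
  have [a2|a2] := eqVneq (A2 p x) 0; last by case: nondeg => //; right.
  by rewrite /angle_eq a1 a2 !mul0r.
rewrite /angle_eq /A1 /A2 sinD sinB => e.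
by apply: (eq_of_mul_sub (k := -1) e); ring.
Qed.

(** The real part of the balance condition is [B1 = B3 sin t - B2 cos t]. It is imposed outside the
    degenerate case and has to be derived within it. *)
Lemma angle_for_re x t : nonzero_root p x -> angle_for p x t ->
  (x ^+ 2 * cc p ^+ 2 + 1) ^+ 2 *
    (x * g1 p + (x ^+ 2 - 1) * g13 p * cos (t + phi p)) =
  cc p * (x ^+ 2 + 1) ^+ 2 *
    (x * cc p * g2 p + (x ^+ 2 * cc p ^+ 2 - 1) * g23 p * cos (t - phi p)).
Proof.
move=> rx [_ nondeg deg].
have : B1 p x = B3 p x * sin t - B2 p x * cos t; last first.
  rewrite /B1 /B2 /B3 cosD cosB => e.
  by apply: (eq_of_mul_sub (k := 1) e); ring.
have [a1|a1] := eqVneq (A1 p x) 0; last by case: nondeg => //; left.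
have [a2|a2] := eqVneq (A2 p x) 0; last by case: nondeg => //; right.
have := deg (conj a1 a2); rewrite /angle_eq_degenerate.
have [g10 g20 p0 cg uv] := degenerate_coeffs rx a1 a2.
rewrite /B1 /B2 /B3 p0 sin0 cos0 !mulr1 mulr0 mul0r sub0r.
(* After multiplication by [c g23^2], the goal is a combination of the equation for [cos t] and the
   relation [A1 = 0], which reads [c v g23 = u g13] with [u], [v] as below. *)
move=> e; have k0 : cc p * g23 p ^+ 2 != 0.
  by rewrite mulf_neq0 ?expf_neq0 // gt_eqF.
apply: (mulfI k0).
pose u := x ^+ 2 * cc p ^+ 2 + 1; pose v := x ^+ 2 + 1.
apply: (eq_of_mul_sub2 (k := - u ^+ 2) e
  (l := cos t * (2 * u * g13 p * g23 p
          - cc p * g23 p ^+ 2 * v * (x ^+ 2 * cc p ^+ 2 - 1))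
        - cc p * x * g2 p * (cc p * v * g23 p + u * g13 p)) uv).
by rewrite /u /v; ring.
Qed.

End Coeffs.
End Angle.

(** * Candidates *)

Section Expi.
Variable R : realType.
Local Notation "x %:C" := (real_complex _ x) : ring_scope.
Implicit Types (x t s a b d : R).

Lemma conj_real x : (x%:C)^* = x%:C :> R[i].
Proof. by apply/eqP; rewrite eq_complex /= oppr0 !eqxx. Qed.

Lemma expiN t : expi (- t) = (expi t)^*.
Proof. by rewrite /expi cosN sinN. Qed.

Lemma expiD t s : expi (t + s) = expi t * expi s.
Proof.
by apply/eqP; rewrite eq_complex /= cosD sinD eqxx addrC eqxx.
Qed.

Lemma expi_mul_conj t : expi t * (expi t)^* = 1.
Proof.
apply/eqP; rewrite eq_complex /=; apply/andP; split; apply/eqP.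
  by rewrite mulrN opprK -!expr2 cos2Dsin2.
by ring.
Qed.

Lemma complex_real_expi a b d s :
  a%:C + b%:C * expi s - d%:C * (expi s)^* =
  Complex (a + (b - d) * cos s) ((b + d) * sin s).
Proof.
by apply/eqP; rewrite eq_complex /=; apply/andP; split; apply/eqP; ring.
Qed.

End Expi.

Section Candidates.
Variables (R : realType) (H : vectType R[i]) (ip : {dot H for Num.conj}).
Implicit Types (u v w p q : H) (a z : R[i]) (A F G : 'End(H)).
Local Notation "<[ u | v ]>" := (braket ip u v).
Local Notation "x %:C" := (real_complex _ x) : ring_scope.

Lemma onb_kerC G p q : onb_ker ip G p q -> onb_ker ip G q p.
Proof.
case=> [[Gp Gq] [pp qq pq] Gb]; split=> //.
  by split=> //; rewrite (braketC ip p q) pq conjC0.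
by move=> w /Gb {1}->; rewrite addrC.
Qed.

Lemma onb_ker_of_basis G p q :
  basis_of (lker G) [:: p; q] -> orthonormal ip [:: p; q] -> onb_ker ip G p q.
Proof.
move=> Gb /orthonormal2P[qp pp qq].
have pq : <[q | p]> = 0 by [].
have qp' : <[p | q]> = 0 by rewrite (braketC ip q p) pq conjC0.
have inG w : w \in [:: p; q] -> G w = 0.
  by move=> /(basis_mem Gb) /lkerP.
split=> [|//|w /lkerP]; first by split; apply: inG; rewrite !inE eqxx ?orbT.
rewrite -(span_basis Gb) span_cons span_seq1 => /memv_addP[_ /vlineP[a ->]].
case=> _ /vlineP[b ->] ->; rewrite !braketE.
have -> : <[p | p]> = 1 by []. have -> : <[q | q]> = 1 by [].
by rewrite pq qp' !mulr0 !mulr1 addr0 add0r.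
Qed.

(** The coefficient matrix is Hermitian and squares to the identity, hence it is unitary and its own
    inverse. *)
Lemma onb_ker_rot G p q a z : onb_ker ip G p q ->
  a^* = a -> a * a * (1 + z * z^*) = 1 ->
  onb_ker ip G (a *: (p + z *: q)) (a *: (z^* *: p - q)).
Proof.
move=> [[Gp Gq] [pp qq pq] Gb] aC az.
have qp : <[q | p]> = 0 by rewrite (braketC ip p q) pq conjC0.
split.
- by split; rewrite linearZ /= ?linearB ?linearD /= linearZ /= Gp Gq
    !(scaler0, addr0, oppr0).
- rewrite !braketE !conjCK pp qq pq qp aC; split.
  + by rewrite -[RHS]az; ring.
  + by rewrite -[RHS]az; ring.
  + by ring.
- move=> w /Gb wE; rewrite {1}wE !braketE !conjCK aC.
  set x := <[p | w]>; set y := <[q | w]>.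
  rewrite -[in LHS](mul1r x) -[in LHS](mul1r y) -az.
  rewrite !(scalerDr, scalerN, scalerA).
  rewrite addrACA -!scalerDl -scalerBl.
  by congr (_ *: _ + _ *: _); ring.
Qed.

Lemma onb_ker_orth_eq0 G G' p q w : onb_ker ip G p q ->
  (supp ip G :&: lker G')%VS = 0%VS -> G' w = 0 ->
  <[p | w]> = 0 -> <[q | w]> = 0 -> w = 0.
Proof.
case=> _ _ Gb cap0 G'w pw qw; apply/eqP; rewrite -memv0 -cap0 memv_cap.
apply/andP; split; last by apply/lkerP.
apply/mem_orthovP => v /lkerP /Gb vE; rewrite -[LHS]/<[v | w]> vE.
by rewrite !braketE pw qw !mulr0 addr0.
Qed.


(** * Overlaps and coefficients of the Jordan bases *)

Variables (G1 G2 : 'End(H)) (k11 k12 k21 k22 : H) (p : coeffs R).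
Hypotheses (G1psd : psd ip G1) (G2psd : psd ip G2).
Hypothesis ker_ker : (lker G1 :&: lker G2)%VS = 0%VS.
Hypothesis supp_ker : (supp ip G1 :&: lker G2)%VS = 0%VS.
Hypothesis k_jordan : jordan_bases ip G1 G2 k11 k12 k21 k22.
Hypothesis p_coeffs : coeffs_of ip G1 G2 k11 k12 k21 k22 p.

Lemma ker_ker_eq0 w : G1 w = 0 -> G2 w = 0 -> w = 0.
Proof.
move=> /lkerP w1 /lkerP w2; apply/eqP.
rewrite -memv0 -ker_ker memv_cap; apply/andP.
split; [exact: w1 | exact: w2].
Qed.

Lemma jordan_onb1 : onb_ker ip G1 k11 k12.
Proof. by case: k_jordan => -[b o] _ _ _ _; apply: onb_ker_of_basis. Qed.

Lemma jordan_onb2 : onb_ker ip G2 k21 k22.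
Proof. by case: k_jordan => _ [b o] _ _ _; apply: onb_ker_of_basis. Qed.

Lemma jordan_orth : <[k11 | k22]> = 0 /\ <[k12 | k21]> = 0.
Proof. by case: k_jordan. Qed.

(** If the overlap vanished, [k21] would be orthogonal to all of the kernel of [G1], hence lie in
    [supp ip G1] and in the kernel of [G2]. *)
Lemma overlap1_gt0 : 0 < <[k11 | k21]>.
Proof.
have [_ k1221] := jordan_orth; have [[G2k _] [kk _ _] _] := jordan_onb2.
case: k_jordan => _ _ _ [c_ge0 _] _; rewrite lt_def c_ge0 andbT; apply/eqP.
move=> c0; have k0 := onb_ker_orth_eq0 jordan_onb1 supp_ker G2k c0 k1221.
by move/eqP: kk; rewrite k0 braket0r eq_sym oner_eq0.
Qed.

Lemma overlap2_gt0 : 0 < <[k12 | k22]>.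
Proof.
have [k1122 _] := jordan_orth; have [[_ G2k] [_ kk _] _] := jordan_onb2.
case: k_jordan => _ _ _ [_ c_ge0] _; rewrite lt_def c_ge0 andbT; apply/eqP.
move=> c0; have k0 := onb_ker_orth_eq0 jordan_onb1 supp_ker G2k k1122 c0.
by move/eqP: kk; rewrite k0 braket0r eq_sym oner_eq0.
Qed.

Lemma overlap2E : <[k12 | k22]> = (cc p)%:C * <[k11 | k21]>.
Proof.
by case: p_coeffs => -> _ _ _ _; rewrite divfK // gt_eqF // overlap1_gt0.
Qed.

Lemma cc_gt0 : 0 < cc p.
Proof.
rewrite -ltcR; case: p_coeffs => -> _ _ _ _.
by rewrite divr_gt0 ?overlap1_gt0 ?overlap2_gt0.
Qed.

Lemma g13_ge0 : 0 <= g13 p.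
Proof.
by rewrite -lecR; case: p_coeffs => _ _ [-> _] _ _; apply: normr_ge0.
Qed.

Lemma g23_ge0 : 0 <= g23 p.
Proof.
by rewrite -lecR; case: p_coeffs => _ _ [_ ->] _ _; apply: normr_ge0.
Qed.

(** [cc p = 1] means equal overlaps, where the remaining freedom in the bases was used to remove the
    off-diagonal element of [G1]. *)
Lemma cc1_g13 : cc p = 1 -> g13 p = 0.
Proof.
move=> c1; case: k_jordan => _ _ _ _ [_ g0].
apply: complexI; case: p_coeffs => _ _ [-> _] _ _.
by rewrite g0 ?normr0 // overlap2E c1 mul1r.
Qed.

(** * Candidates satisfy orthogonality and balance *)

(** Both pairs have the shape of [onb_ker_rot], the second one rotating [k12], [k11]. The real
    argument [r] stands for [|z|^2]. *)
Definition basis_pair_of (c r : R) z : basis_pair H :=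
  let n1 := ((Num.sqrt (1 + r))^-1)%:C in
  let n2 := ((Num.sqrt (1 + c ^+ 2 * r))^-1)%:C in
  BasisPair (n1 *: (k21 + z *: k22)) (n1 *: (z^* *: k21 - k22))
    (n2 *: (k12 + (- (z^* * c%:C)) *: k11))
    (n2 *: ((- (z^* * c%:C))^* *: k12 - k11)).

Lemma basis_pair_atE (x t : R) : basis_pair_at k11 k12 k21 k22 p x t =
  basis_pair_of (cc p) (x ^+ 2) (x%:C * expi t).
Proof.
rewrite /basis_pair_at /basis_pair_of expiN !rmorphN !rmorphM /= !conjCK.
rewrite !conj_real; congr BasisPair; congr (_ *: _).
  by rewrite addrC.
by rewrite addrC scaleNr.
Qed.

Lemma polar_mul_conj (x t : R) :
  (x%:C * expi t) * (x%:C * expi t)^* = (x ^+ 2)%:C.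
Proof.
by rewrite rmorphM /= conj_real mulrACA expi_mul_conj mulr1 -rmorphM expr2.
Qed.

Lemma sqrtV_mul (r : R) : 0 <= r ->
  ((Num.sqrt (1 + r))^-1)%:C * ((Num.sqrt (1 + r))^-1)%:C * (1 + r)%:C = 1.
Proof.
move=> r_ge0; have r1 : 0 < 1 + r by rewrite ltr_pwDl.
rewrite -!rmorphM -invfM -expr2 sqr_sqrtr ?ltW // mulVf ?gt_eqF //.
Qed.

(** What [optimal_usd_ketbra] requires of the vectors, apart from the two inequalities. *)
Definition is_frame (b : basis_pair H) : Prop :=
  [/\ onb_ker ip G2 (psi1 b) (psi1p b), onb_ker ip G1 (psi2 b) (psi2p b),
      <[psi1 b | psi2 b]> = 0,
      <[psi1p b | psi2 b]> != 0 /\ <[psi2p b | psi1 b]> != 0 &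
      <[psi1p b | G1 (psi1 b)]> / <[psi1p b | psi2 b]>
      = (<[psi2p b | G2 (psi2 b)]> / <[psi2p b | psi1 b]>)^*].

Lemma overlap_conj :
  <[k21 | k11]> = <[k11 | k21]> /\ <[k22 | k12]> = <[k12 | k22]>.
Proof.
by split; rewrite braketC geC0_conj // ltW ?overlap1_gt0 ?overlap2_gt0.
Qed.

Lemma overlap_cross : <[k21 | k12]> = 0 /\ <[k22 | k11]> = 0.
Proof.
have [k1122 k1221] := jordan_orth.
by split; rewrite braketC ?k1122 ?k1221 conjC0.
Qed.

(** When [sin (phi p) = 0] the phase is real, and the balance condition reduces to [c g23 = g13]. *)
Lemma is_frame1 : sin (phi p) = 0 -> cc p * g23 p = g13 p ->
  is_frame (BasisPair k21 k22 k12 k11).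
Proof.
move=> s0 cg; have c1 := overlap1_gt0; have c2 := overlap2_gt0.
have [_ e22] := overlap_conj; have [e12 _] := overlap_cross.
split=> /=; [exact: jordan_onb2|exact: onb_kerC jordan_onb1|by []| |].
  by rewrite e22 !gt_eqF.
case: p_coeffs => _ _ _ [G1k G2k] _.
have cn0 : (cc p)%:C != 0 :> R[i] by rewrite gt_eqF // ltcR cc_gt0.
rewrite e22 overlap2E (psd_herm G1psd k21 k22) G1k G2k -cg.
rewrite rmorphM /= !rmorphM /= !expiN fmorphV /= !conj_real conjCK.
rewrite (geC0_conj (ltW c1)).
have -> : (expi (phi p))^* = expi (phi p).
  by rewrite -expiN /expi cosN sinN s0 oppr0.
by field; rewrite cn0 gt_eqF.
Qed.

Lemma is_frame2 : sin (phi p) = 0 -> cc p * g13 p = g23 p ->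
  is_frame (BasisPair k22 k21 k11 k12).
Proof.
move=> s0 cg; have c1 := overlap1_gt0; have c2 := overlap2_gt0.
have [e11 _] := overlap_conj; have [_ e21] := overlap_cross.
split=> /=; [exact: onb_kerC jordan_onb2|exact: jordan_onb1|by []| |].
  by rewrite e11 !gt_eqF.
case: p_coeffs => _ _ _ [G1k G2k] _.
have cn0 : (cc p)%:C != 0 :> R[i] by rewrite gt_eqF // ltcR cc_gt0.
rewrite e11 overlap2E (psd_herm G2psd k11 k12) G1k G2k -cg.
rewrite rmorphM /= !rmorphM /= !expiN fmorphV /= !rmorphM /= !conjCK !conj_real.
rewrite (geC0_conj (ltW c1)).
have -> : (expi (phi p))^* = expi (phi p).
  by rewrite -expiN /expi cosN sinN s0 oppr0.
by field; rewrite cn0 gt_eqF.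
Qed.


(* The matrix elements in the optimality condition, with the phase of the root
   [z = x e^(it)] factored out; real and imaginary part then give the equations
   for [x] and for the angle. *)
Lemma balance_polar (x t s a b y : R) :
  x%:C * expi t * a%:C + y%:C * (x%:C * expi t) ^+ 2 * (b%:C * expi s)
    - (b%:C * expi s)^* =
  expi t * Complex (x * a + (y * x ^+ 2 - 1) * b * cos (t + s))
                   ((y * x ^+ 2 + 1) * b * sin (t + s)).
Proof.
have -> : Complex (x * a + (y * x ^+ 2 - 1) * b * cos (t + s))
                  ((y * x ^+ 2 + 1) * b * sin (t + s)) =
  (x * a)%:C + (y * x ^+ 2 * b)%:C * expi (t + s) - b%:C * (expi (t + s))^*.
  by rewrite complex_real_expi; congr Complex; ring.
rewrite expiD !rmorphM /= conj_real.
by apply: (eq_of_mul_sub (k := b%:C * (expi s)^*) (expi_mul_conj t)); ring.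
Qed.

(** The balance condition with denominators cleared. Once [expi t] is cancelled, its real and
    imaginary parts are [angle_for_re] and a multiple of [angle_for_im]. *)
Lemma balance_identity (x t : R) : nonzero_root p x -> angle_for p x t ->
  let z := x%:C * expi t in
  (1 + cc p ^+ 2 * x ^+ 2)%:C ^+ 2 *
    (z * (g1 p)%:C + z ^+ 2 * <[k21 | G1 k22]> - <[k21 | G1 k22]>^*) =
  (cc p)%:C * (1 + x ^+ 2)%:C ^+ 2 *
    (z * (cc p * g2 p)%:C + (cc p ^+ 2)%:C * z ^+ 2 * <[k11 | G2 k12]>
     - <[k11 | G2 k12]>^*).
Proof.
move=> rx ax z; case: p_coeffs => _ _ _ [-> ->] [phi_range phi0].
have re := angle_for_re cc_gt0 phi_range phi0 g13_ge0 g23_ge0 cc1_g13 rx ax.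
have im := angle_for_im ax.
have := balance_polar x t (phi p) (g1 p) (g13 p) 1.
rewrite rmorph1 !mul1r => ->.
rewrite balance_polar !(mulrCA _ (expi t)); congr (_ * _).
rewrite -!rmorphXn -rmorphM; apply/eqP; rewrite eq_complex /=.
rewrite !mul0r !subr0 !addr0; apply/andP; split; apply/eqP.
  by apply: (eq_of_mul_sub (k := 1) re); ring.
apply: (eq_of_mul_sub
  (k := (1 + cc p ^+ 2 * x ^+ 2) * (1 + x ^+ 2)) im); ring.
Qed.

(** The second rotation uses [y = - c z^*] because the second Jordan overlap is [c] times the first,
    so that [psi1] and [psi2] become orthogonal. The overlaps [s1] and [s2] are then explicit, and
    balance reduces to [balance_identity]. *)
Lemma is_frame3 (x t : R) : nonzero_root p x -> angle_for p x t ->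
  is_frame (basis_pair_at k11 k12 k21 k22 p x t).
Proof.
move=> rx ax; have := balance_identity rx ax.
rewrite basis_pair_atE /basis_pair_of; move: (polar_mul_conj x t) => /=.
set z := x%:C * expi t; set c := cc p; set y := - (z^* * c%:C).
set n1 := ((Num.sqrt (1 + x ^+ 2))^-1)%:C.
set n2 := ((Num.sqrt (1 + c ^+ 2 * x ^+ 2))^-1)%:C.
move=> zz core; have yE : y = - (z^* * c%:C) by [].
clearbody y z.
have n1C : n1^* = n1 by rewrite conj_real.
have n2C : n2^* = n2 by rewrite conj_real.
have yC : y^* = - (z * c%:C).
  by rewrite yE rmorphN rmorphM /= conjCK conj_real.
have XE : (1 + x ^+ 2)%:C = 1 + z * z^* by rewrite zz rmorphD rmorph1.
have UE : (1 + c ^+ 2 * x ^+ 2)%:C = 1 + c%:C * c%:C * (z * z^*).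
  by rewrite zz -!rmorphM -expr2 rmorphD rmorph1.
have yy : 1 + y * y^* = (1 + c ^+ 2 * x ^+ 2)%:C by rewrite UE yC yE; ring.
have nX : n1 * n1 * (1 + x ^+ 2)%:C = 1 by apply: sqrtV_mul; apply: sqr_ge0.
have nU : n2 * n2 * (1 + c ^+ 2 * x ^+ 2)%:C = 1.
  by apply: sqrtV_mul; rewrite -exprMn sqr_ge0.
have nX' : n1 * n1 * (1 + z * z^*) = 1 by rewrite -XE nX.
have nU' : n2 * n2 * (1 + y * y^*) = 1 by rewrite yy nU.
have c1 := overlap1_gt0; have c2 := overlap2_gt0; have c2E := overlap2E.
have [e11 e22] := overlap_conj; have [e12 e21] := overlap_cross.
have [e1122 e1221] := jordan_orth.
have cn0 : c%:C != 0 :> R[i] by rewrite gt_eqF // ltcR cc_gt0.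
have s1 : <[n1 *: (z^* *: k21 - k22) | n2 *: (k12 + y *: k11)]> =
    - (n1 * n2 * c%:C * <[k11 | k21]> * (1 + x ^+ 2)%:C).
  by rewrite !braketE conjCK n1C e11 e22 e12 e21 c2E XE yE; ring.
have s2 : <[n2 *: (y^* *: k12 - k11) | n1 *: (k21 + z *: k22)]> =
    - (n1 * n2 * <[k11 | k21]> * (1 + c ^+ 2 * x ^+ 2)%:C).
  by rewrite !braketE conjCK n2C e1122 e1221 c2E UE yE; ring.
have neq0_of_mul1 (a b : R[i]) : a * a * b = 1 -> a != 0 /\ b != 0.
  move=> ab; have : a * a * b != 0 by rewrite ab oner_neq0.
  by rewrite !mulf_eq0 !negb_or => /andP[/andP[]].
have [n10 X0] := neq0_of_mul1 _ _ nX.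
have [n20 U0] := neq0_of_mul1 _ _ nU.
have c10 : <[k11 | k21]> != 0 by rewrite gt_eqF.
split=> /=.
- exact: onb_ker_rot jordan_onb2 n1C nX'.
- exact: onb_ker_rot (onb_kerC jordan_onb1) n2C nU'.
- by rewrite !braketE e11 e22 e12 e21 c2E yE; ring.
- by rewrite s1 s2 !oppr_eq0 !mulf_neq0.
have t1 : <[n1 *: (z^* *: k21 - k22) | G1 (n1 *: (k21 + z *: k22))]> =
    n1 * n1 * (z * (g1 p)%:C + z ^+ 2 * <[k21 | G1 k22]> - <[k21 | G1 k22]>^*).
  have -> : G1 (n1 *: (k21 + z *: k22)) = n1 *: (G1 k21 + z *: G1 k22).
    by rewrite linearZ linearD linearZ.
  rewrite !braketE conjCK n1C.
  rewrite (psd_herm G1psd k21 k22) rmorphB /=.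
  by case: p_coeffs => _ [-> -> _ _] _ _ _; ring.
have t2 : <[n2 *: (y^* *: k12 - k11) | G2 (n2 *: (k12 + y *: k11))]>^* =
    n2 * n2 * (z * (c * g2 p)%:C + (c ^+ 2)%:C * z ^+ 2 * <[k11 | G2 k12]>
     - <[k11 | G2 k12]>^*).
  have -> : G2 (n2 *: (k12 + y *: k11)) = n2 *: (G2 k12 + y *: G2 k11).
    by rewrite linearZ linearD linearZ.
  rewrite !braketE conjCK n2C.
  rewrite (psd_herm G2psd k11 k12).
  rewrite !(rmorphD, rmorphB, rmorphN, rmorphM) /= conjCK n2C yC.
  rewrite !(psd_real _ G2psd) expr2.
  by case: p_coeffs => _ [_ _ -> ->] _ _ _; ring.
move: core t1 t2; set P := _ - _; set Q := _ - _ => core t1 t2.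
rewrite rmorphM fmorphV /= t2 t1 s1 s2 rmorphN !rmorphM /= n1C n2C conj_real.
rewrite (geC0_conj (ltW c1)).
(* The normalizations [n1^2 (1 + x^2) = 1] and [n2^2 (1 + c^2 x^2) = 1] absorb one factor of each
   kind from the squared factors. *)
have {}core : n1 * n1 * P * (1 + c ^+ 2 * x ^+ 2)%:C =
    n2 * n2 * Q * (c%:C * (1 + x ^+ 2)%:C).
  apply: (mulfI (mulf_neq0 X0 U0)).
  transitivity (n1 * n1 * (1 + x ^+ 2)%:C *
    ((1 + c ^+ 2 * x ^+ 2)%:C ^+ 2 * P)).
    by ring.
  by rewrite nX core -nU; ring.
apply/eqP; rewrite !invrN !mulrN eqr_opp eqr_div ?mulf_neq0 //; apply/eqP.
transitivity (n1 * n2 * <[k11 | k21]> *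
  (n1 * n1 * P * (1 + c ^+ 2 * x ^+ 2)%:C)).
  by ring.
by rewrite core; ring.
Qed.


Lemma candidate_frame b : candidate k11 k12 k21 k22 p b -> is_frame b.
Proof.
by case=> [[s0 cg ->]|[s0 cg ->]|[x [t [rx ax ->]]]];
  [exact: is_frame1|exact: is_frame2|exact: is_frame3].
Qed.

(* A candidate is determined by the ray of its [psi1]: in the last case already
   by [z], since [r] is its squared modulus. *)
Variant psi1_coords_spec (b : basis_pair H) : R[i] -> R[i] -> Prop :=
  | Psi1Coords10 of b = BasisPair k21 k22 k12 k11 : psi1_coords_spec b 1 0
  | Psi1Coords01 of b = BasisPair k22 k21 k11 k12 : psi1_coords_spec b 0 1
  | Psi1CoordsRoot (r : R) a z of z * z^* = r%:C & a != 0 & z != 0 & a^* = a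
      & b = basis_pair_of (cc p) r z : psi1_coords_spec b a (a * z).

Lemma psi1_coordsP b : candidate k11 k12 k21 k22 p b ->
  psi1_coords_spec b <[k21 | psi1 b]> <[k22 | psi1 b]>.
Proof.
have [_ [e11 e22 e12] _] := jordan_onb2.
have e21 : <[k22 | k21]> = 0 by rewrite (braketC ip k21) e12 conjC0.
case=> [[_ _ ->]|[_ _ ->]|[x [t [rx ax ->]]]].
- by rewrite /= e11 e21; apply: Psi1Coords10.
- by rewrite /= e22 e12; apply: Psi1Coords01.
rewrite basis_pair_atE /= !braketE e11 e12 e21 e22 mulr0 mulr1 addr0 add0r.
have x0 : x != 0 by case: rx.
rewrite mulr1.
apply: Psi1CoordsRoot (polar_mul_conj x t) _ _ (conj_real _) _ => //.
  apply/eqP => n0; have /eqP := sqrtV_mul (sqr_ge0 x).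
  by rewrite n0 !mul0r eq_sym oner_eq0.
apply/eqP => z0; have /esym/eqP := polar_mul_conj x t.
by rewrite z0 mul0r -[0]/(0%:C) (inj_eq (@complexI R)) sqrf_eq0 (negPf x0).
Qed.

(** The diagonal entries of [|psi1><psi1|] in the basis [k21], [k22] tell the three kinds apart. For
    two roots, the entries [a^2] and [a^2 z] determine [z]. *)
Lemma candidate_inj b b' :
  candidate k11 k12 k21 k22 p b -> candidate k11 k12 k21 k22 p b' ->
  ketbra ip (psi1 b) (psi1 b) = ketbra ip (psi1 b') (psi1 b') -> b = b'.
Proof.
move=> /psi1_coordsP cb /psi1_coordsP cb' /lfunP Eb.
have E u v : <[u | psi1 b]> * <[v | psi1 b]>^* =
    <[u | psi1 b']> * <[v | psi1 b']>^*.
  have /(congr1 (braket ip u)) := Eb v; rewrite !ketbraE !braketZr.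
  by rewrite (braketC ip v) (braketC ip v (psi1 b')) mulrC => ->; rewrite mulrC.
have := E k22 k21; have := E k22 k22; have := E k21 k21; clear E Eb.
case: cb => [->|->|r a z zr a0 z0 aC ->];
  case: cb' => [->|->|r' a' z' zr' a'0 z'0 a'C ->] //.
all: rewrite ?conjC0 ?conjC1 ?rmorphM /= ?aC ?a'C ?mulr0 ?mul0r ?mulr1.
all: move=> /eqP e11 /eqP e22 /eqP e21; move: e11 e22 e21.
- by rewrite oner_eq0.
- by move=> _; rewrite eq_sym !mulf_eq0 conjC_eq0 (negPf a'0) (negPf z'0).
- by rewrite eq_sym oner_eq0.
- by rewrite eq_sym !mulf_eq0 (negPf a'0).
- by move=> _; rewrite !mulf_eq0 conjC_eq0 (negPf a0) (negPf z0).
- by rewrite !mulf_eq0 (negPf a0).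
move=> /eqP aa _ /eqP; rewrite [a * z]mulrC [a' * z']mulrC -!mulrA -aa.
have aa0 : a * a != 0 by rewrite mulf_neq0.
move=> /(mulIf aa0) zz.
have rr : r = r' by apply: complexI; rewrite -zr -zr' zz.
by rewrite zz rr.
Qed.

(** * Optimality and uniqueness of the candidates *)

Lemma candidate_optimal b : candidate k11 k12 k21 k22 p b ->
  psi_inequalities ip G1 G2 b -> forall E1 E2 Eq : 'End(H),
    is_optimal_usd ip G1 G2 E1 E2 Eq <->
    [/\ E1 = ketbra ip (psi1 b) (psi1 b), E2 = ketbra ip (psi2 b) (psi2 b) &
        Eq = \1%VF - E1 - E2].
Proof.
move=> /candidate_frame[onb2 onb1 o12 [s1 s2] bal] [ineq1 ineq2] E1 E2 Eq.
exact: (optimal_usd_ketbra G1psd G2psd ker_ker_eq0 onb2 onb1 o12 s1 s2 bal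
  ineq1 ineq2).
Qed.

(** The measurement built from [b] is optimal, while the certificate of [b'] admits only the
    measurement built from [b']; so the projections onto [psi1] agree. *)
Lemma candidate_unique b b' :
  candidate k11 k12 k21 k22 p b -> psi_inequalities ip G1 G2 b ->
  candidate k11 k12 k21 k22 p b' -> psi_inequalities ip G1 G2 b' -> b = b'.
Proof.
move=> cb ib cb' ib'; apply: candidate_inj => //.
have /(candidate_optimal cb' ib')[] //: is_optimal_usd ip G1 G2
    (ketbra ip (psi1 b) (psi1 b)) (ketbra ip (psi2 b) (psi2 b))
    (\1%VF - ketbra ip (psi1 b) (psi1 b) - ketbra ip (psi2 b) (psi2 b)).
exact/(candidate_optimal cb ib).
Qed.

End Candidates.

Theorem mainTheorem7 (R : realType) (H : vectType R[i])
  (ip : {dot H for Num.conj}) (gamma1 gamma2 : 'End(H))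
  (k11 k12 k21 k22 : H) (p : coeffs R)
  (dimH : \dim {:H} = 4%N)
  (gamma1_psd : psd ip gamma1) (gamma2_psd : psd ip gamma2)
  (supp_supp : (supp ip gamma1 :&: supp ip gamma2)%VS = 0%VS)
  (ker_ker : (lker gamma1 :&: lker gamma2)%VS = 0%VS)
  (supp_ker : (supp ip gamma1 :&: lker gamma2)%VS = 0%VS)
  (ker_supp : (lker gamma1 :&: supp ip gamma2)%VS = 0%VS)
  (k_jordan : jordan_bases ip gamma1 gamma2 k11 k12 k21 k22)
  (p_coeffs : coeffs_of ip gamma1 gamma2 k11 k12 k21 k22 p) :
  [/\ (forall x : R, nonzero_root p x -> A1 p x != 0 \/ A2 p x != 0 ->
         exists! t : R, angle_range t /\ angle_eq p x t),
      (forall x : R, nonzero_root p x -> A1 p x = 0 /\ A2 p x = 0 ->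
         forall t t' : R,
           angle_range t -> angle_eq_degenerate p x t ->
           angle_range t' -> angle_eq_degenerate p x t' -> cos t = cos t'),
      (forall b b' : basis_pair H,
         candidate k11 k12 k21 k22 p b ->
         psi_inequalities ip gamma1 gamma2 b ->
         candidate k11 k12 k21 k22 p b' ->
         psi_inequalities ip gamma1 gamma2 b' -> b = b') &
      (forall b : basis_pair H,
         candidate k11 k12 k21 k22 p b ->
         psi_inequalities ip gamma1 gamma2 b ->
         forall E1 E2 Eq : 'End(H),
           is_optimal_usd ip gamma1 gamma2 E1 E2 Eq <->
           [/\ E1 = ketbra ip (psi1 b) (psi1 b),
               E2 = ketbra ip (psi2 b) (psi2 b) &
               Eq = \1%VF - E1 - E2])].
Proof.
have phi_cond : 0 <= phi p < pi /\ (g13 p = 0 \/ g23 p = 0 -> phi p = 0).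
  by case: p_coeffs.
have c_gt0 := cc_gt0 supp_ker k_jordan p_coeffs.
have c1 := cc1_g13 supp_ker k_jordan p_coeffs.
split.
- by move=> x _ A0; apply: exists_unique_angle A0.
- move=> x rx [a1 a2] t t' _ et _ et'; case: phi_cond => phi_range phi0.
  exact: (degenerate_cos_unique c_gt0 phi_range phi0 (g13_ge0 p_coeffs)
    (g23_ge0 p_coeffs) c1 rx a1 a2 et et').
- exact: candidate_unique.
- exact: candidate_optimal.
Qed.
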